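(* Let $p$ be a sufficiently large prime and let $k \geq 4$ be even. Let $\Psi$ be a $2\times k$ system of linear equations over $\mathbb{F}_p$ such that $s(\Psi)=k-1$. Let $m\ge 2$ and $t\geq k$. If $\Psi'$ is an $m\times t$ system of linear equations over $\mathbb{F}_p$ that has $s(\Psi') = k-1$ and that contains $\Psi$, then $\Psi'$ is uncommon.
   Context: An $m\times t$ system $\Psi$ is a system of $m$ homogeneous linear equations in $t$ variables, given by an $m\times t$ matrix $M_\Psi$ over $\mathbb{F}_p$ of full rank $m$, with $t>m$. For $n\ge1$, $\mathrm{sol}(\Psi;\mathbb{F}_p^n)$ is the set of $x=(x_1,\dots,x_t)\in(\mathbb{F}_p^n)^t$ with $M_\Psi x=0$ (each equation applied coordinatewise). For $f:\mathbb{F}_p^n\to\mathbb{C}$, $T_\Psi(f)=\mathbb{E}_{x\in \mathrm{sol}(\Psi;\mathbb{F}_p^n)} f(x_1)\cdots f(x_t)$ (normalised average). The length of an equation is its number of nonzero coefficients; $s(\Psi)$ is the minimum length of a nonzero equation in the row space of $M_\Psi$ (the shortest equation contained in $\Psi$). A $t$-variable system $\Psi'$ is common if for every $n\ge1$ and every $f:\mathbb{F}_p^n\to[0,1]$ one has $T_{\Psi'}(f)+T_{\Psi'}(1-f)\ge 2^{1-t}$, and uncommon otherwise. A $t$-variable system $\Psi'$ contains a $k$-variable system $\Psi$ if there is a set $B$ of $k$ of the variables of $\Psi'$ (with an identification of $B$ with the variables of $\Psi$) such that for every $n$, every solution of $\Psi'$ restricts on the variables in $B$ to a solution of $\Psi$.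 *)

(* Defs.v *)
From HB Require Import structures.
From mathcomp Require Import all_boot all_order all_algebra.
From mathcomp Require Import reals.

Set Implicit Arguments.
Unset Strict Implicit.
Unset Printing Implicit Defensive.

Import Order.TTheory GRing.Theory Num.Theory.
Local Open Scope ring_scope.

(* Throughout, p is meant to be prime, so that 'F_p is the field with p
   elements; M is the coefficient matrix M_Psi of the system Psi. *)

(* An m x t system: t > m and M has full rank m (row_free M is \rank M == m). *)
Definition is_system (p m t : nat) (M : 'M['F_p]_(m, t)) : bool :=
  (m < t)%N && row_free M.

(* A tuple (x_1, ..., x_t) of elements of F_p^n is the t x n matrix x whose
   i-th row is x_i; then M *m x = 0 is each equation applied coordinatewise. *)
Definition sol (p m t : nat) (M : 'M['F_p]_(m, t)) (n : nat) :
    {set 'M['F_p]_(t, n)} :=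
  [set x | M *m x == 0].

(* T_Psi(f).  The scalars C are generic, to cover complex- and real-valued f. *)
Definition T (C : numFieldType) (p m t : nat) (M : 'M['F_p]_(m, t)) (n : nat)
    (f : 'rV['F_p]_n -> C) : C :=
  (\sum_(x in sol M n) \prod_(i < t) f (row i x)) / #|sol M n|%:R.

Definition eq_length (p t : nat) (u : 'rV['F_p]_t) : nat :=
  #|[set j | u 0 j != 0]|.

(* s(Psi).  Lengths never exceed t, so the default value t of the minimum plays
   no role as soon as the row space is nonzero (m > 0 for a system). *)
Definition s (p m t : nat) (M : 'M['F_p]_(m, t)) : nat :=
  \big[minn/t]_(u : 'rV['F_p]_t | (u != 0) && (u <= M)%MS) eq_length u.

Definition common (R : realType) (p m t : nat) (M : 'M['F_p]_(m, t)) : Prop :=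
  forall (n : nat) (f : 'rV['F_p]_n -> R), (0 < n)%N ->
    (forall x, 0 <= f x <= 1) ->
    2 ^ (1 - t%:Z) <= T M f + T M (fun x => 1 - f x).

Definition uncommon (R : realType) (p m t : nat) (M : 'M['F_p]_(m, t)) : Prop :=
  ~ common R M.

(* The injection b encodes the set B of k variables of M' (its image) together
   with the identification of B with the variables of M. *)
Definition contains (p m t l k : nat) (M' : 'M['F_p]_(m, t))
    (M : 'M['F_p]_(l, k)) : Prop :=
  exists2 b : 'I_k -> 'I_t, injective b &
    forall n : nat, (0 < n)%N ->
      forall x, x \in sol M' n -> rowsub b x \in sol M n.

(* Main.v *)
(** Write [f = 1/2 + e g] with [g] the Fourier transform of a function [G] on
    [F_p^n] vanishing at [0].  Then [T(f) + T(1 - f) - 2^(1-t)] is, up to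
    [O(e^(k+1))], a positive multiple of [e^k] times the sum of [\prod G(col i U)]
    over the matrices [U] with rows in the row space of [Psi'] and exactly [k]
    nonzero columns; shorter supports contribute nothing because [k] is even and
    [s(Psi') = k-1].  It suffices to make this sum negative.

    Let [v_j] be the columns of [Psi], and choose nonzero weights [w_j] with
    [\sum_j w_j (l v_j)^(k-2) = 0] for every row vector [l].  On
    [F_p^n = F_p^2 x F_p^N], put [G(v_j, y) = sgn_j chi(w_j \sum_i y_i^(k-2))]
    with one sign equal to [-1] and the others to [1], extend by
    [G(-x) = conj G(x)], and let [G] vanish elsewhere.  Grouping the [U] by their
    first two rows [U1], the sum becomes [\sum alpha(U1) z(U1)^N], where [z(U1)] is a
    character sum over the at most [p^2] codewords supported on the columns of [U1].
    Either [|z| < p^2], or the phase vanishes on all [p^2] codewords; in the latter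
    case the columns of [U1] are, up to sign, the [v_j], each taken once, whence
    [alpha = -1]: they cannot all be [+-v_j] for one [j], because signs [e_i] and
    distinct [m_i] with [\sum e_i (r + m_i)^(k-2) = 0] for all [r] do not exist.
    [U1 = Psi] realises [z = p^2], so the sum is negative for large [N]. *)
Require Import Defs.
From mathcomp Require Import all_boot all_order all_algebra.
From mathcomp Require Import reals complex ring lra zify.

Set Implicit Arguments.
Unset Strict Implicit.
Unset Printing Implicit Defensive.

Import Order.TTheory GRing.Theory Num.Theory.
Local Open Scope ring_scope.

(** * Interpolation and signed moments *)

Lemma size_prod_XsubC_in (F : fieldType) (I : finType) (A : {set I}) (x : I -> F) :
  size (\prod_(i in A) ('X - (x i)%:P)) = #|A|.+1.
Proof. by rewrite -big_enum size_prod_XsubC -cardE. Qed.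

Lemma poly_eq_on (F : fieldType) (I : finType) (A : {set I}) (x : I -> F)
    (g h : {poly F}) :
  {in A &, injective x} -> (size g <= #|A|)%N -> (size h <= #|A|)%N ->
  (forall i, i \in A -> g.[x i] = h.[x i]) -> g = h.
Proof.
move=> xI sg sh gh; apply/eqP; rewrite -subr_eq0; apply/eqP.
apply: (@roots_geq_poly_eq0 _ _ [seq x i | i <- enum A]).
- apply/allP=> _ /mapP[i iA ->]; rewrite mem_enum in iA.
  by rewrite rootE hornerD hornerN gh // subrr.
- rewrite map_inj_in_uniq ?enum_uniq // => i j; rewrite !mem_enum; exact: xI.
- rewrite size_map -cardE (leq_trans (size_polyD _ _)) //.
  by rewrite size_polyN geq_max sg.
Qed.

(** Take the coefficient of degree [#|A| - 1] in Lagrange's interpolation formula: each basis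
    polynomial has a monic numerator of exactly that degree. *)
Lemma lagrange_lead_coef (F : fieldType) (I : finType) (A : {set I}) (x : I -> F)
    (h : {poly F}) :
  {in A &, injective x} -> (size h <= #|A|)%N ->
  \sum_(i in A) h.[x i] / \prod_(j in A :\ i) (x i - x j) = h`_(#|A|.-1).
Proof.
move=> xI sh.
pose L i := \prod_(j in A :\ i) ('X - (x j)%:P).
pose w i := \prod_(j in A :\ i) (x i - x j).
have Lw i : (L i).[x i] = w i.
  by rewrite horner_prod; apply: eq_bigr => j _; rewrite hornerXsubC.
have w0 i : i \in A -> w i != 0.
  move=> iA; apply/prodf_neq0 => j; rewrite !inE subr_eq0 => /andP[ji jA].
  by apply: contraNneq ji => e; rewrite (xI _ _ jA iA (esym e)).
have sL i : i \in A -> size (L i) = #|A|.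
  by move=> iA; rewrite size_prod_XsubC_in (cardsD1 i A) iA.
have Lc i : i \in A -> (L i)`_(#|A|.-1) = 1.
  move=> iA; rewrite -(sL i iA); apply/eqP; exact: monic_prod_XsubC.
have -> : h = \sum_(i in A) (h.[x i] / w i) *: L i.
  apply: (poly_eq_on xI sh) => [|i iA].
    apply: (leq_trans (size_sum _ _ _)); apply/bigmax_leqP => i iA.
    by rewrite -(sL i iA); exact: size_scale_leq.
  rewrite horner_sum (bigD1 i) //= hornerZ Lw divfK ?w0 // big1 ?addr0 //.
  move=> j /andP[jA ji]; rewrite hornerZ horner_prod (bigD1 i) /=; last first.
    by rewrite !inE eq_sym ji.
  by rewrite hornerXsubC subrr mul0r mulr0.
rewrite coef_sum; apply: eq_bigr => i iA.
rewrite coefZ Lc // mulr1 horner_sum (bigD1 i) //= hornerZ Lw divfK ?w0 //.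
rewrite big1 ?addr0 // => j /andP[jA ji].
rewrite hornerZ horner_prod (bigD1 i) /=; last by rewrite !inE eq_sym ji.
by rewrite hornerXsubC subrr mul0r mulr0.
Qed.

Lemma coefM_top (F : fieldType) (g h : {poly F}) (i j : nat) :
  (size g <= i.+1)%N -> (size h <= j.+1)%N -> (g * h)`_(i + j) = g`_i * h`_j.
Proof.
move=> sg sh; rewrite coefM.
have ilt : (i < (i + j).+1)%N by rewrite ltnS leq_addr.
rewrite (bigD1 (Ordinal ilt)) //= addKn big1 ?addr0 // => l li.
have {}li : (l : nat) != i by apply: contra li => /eqP li; apply/eqP/val_inj.
case: (ltnP i l) => il; first by rewrite nth_default ?mul0r // (leq_trans sg).
rewrite (nth_default _ (n := (i + j - l)%N)) ?mulr0 //.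
by apply: (leq_trans sh); move: li il; lia.
Qed.

Lemma horner_deriv_XsubC_mul (F : fieldType) (a : F) (g : {poly F}) :
  (('X - a%:P) * g)^`().[a] = g.[a].
Proof.
by rewrite derivM hornerD !hornerM derivXsubC hornerC hornerXsubC subrr mul0r mul1r addr0.
Qed.

(** The Euler operator [X d/dX] is diagonal on coefficients, so leading terms of Wronskians can be
    compared without shifting indices. *)
Lemma coefXderiv (F : fieldType) (g : {poly F}) (i : nat) :
  ('X * g^`())`_i = i%:R * g`_i.
Proof. by case: i => [|i]; rewrite coefXM ?mul0r // coef_deriv mulr_natl. Qed.

Lemma size_Xderiv (F : fieldType) (g : {poly F}) : (size ('X * g^`())%R <= size g)%N.
Proof.
by apply/leq_sizeP => i gi; rewrite coefXderiv nth_default // mulr0.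
Qed.

(* With [A] and [B] the products of [X - m i] over the two sign classes, the
   hypothesis makes [A' B - A B'] take the same value at all [m i], so it is
   constant; comparing leading coefficients then forces [A = B]. *)
Lemma signed_moments_nonzero (F : fieldType) (I : finType) (A : {set I})
    (m e : I -> F) :
  (3 < #|A|)%N -> ~~ odd #|A| ->
  (forall n, (0 < n <= #|A|)%N -> n%:R != 0 :> F) ->
  {in A &, injective m} ->
  (forall i, i \in A -> e i = 1 \/ e i = -1) ->
  ~ (forall h : {poly F}, (size h < #|A|)%N -> \sum_(i in A) e i * h.[m i] = 0).
Proof.
move=> A3 Aev chF mI e1 H.
pose P := [set i in A | e i == 1]; pose N := [set i in A | e i != 1].
have N1 i : i \in N -> e i = -1.
  by rewrite inE => /andP[/e1[->|//]]; rewrite eqxx.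
have P1 i : i \in P -> e i = 1 by rewrite inE => /andP[_ /eqP].
have cPN : (#|P| + #|N|)%N = #|A|.
  rewrite -(cardsID P A); congr addn; apply: eq_card => i; rewrite !inE.
    by case: (i \in A).
  by case: (i \in A); rewrite //= andbT.
have sumPN (G : I -> F) : \sum_(i in A) G i = \sum_(i in P) G i + \sum_(i in N) G i.
  rewrite (bigID (fun i => e i == 1)) /=; congr (_ + _).
    by apply: eq_bigl => i; rewrite inE.
  by apply: eq_bigl => i; rewrite inE.
(* The moment of the constant 1 gives the equality in [F]; the hypothesis on the characteristic
   lifts it to the naturals. *)
have ePN : #|P| = #|N|.
  have := H 1; rewrite size_poly1 => /(_ ltac:(by lia)).
  under eq_bigr do rewrite hornerC mulr1.
  rewrite sumPN (eq_bigr _ P1) (eq_bigr _ N1) !sumr_const mulNrn => /eqP.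
  rewrite subr_eq0 => /eqP E; case: (ltngtP #|P| #|N|) => // lt.
    have := chF (#|N| - #|P|)%N ltac:(by lia).
    by rewrite natrB ?(ltnW lt) // E subrr eqxx.
  have := chF (#|P| - #|N|)%N ltac:(by lia).
  by rewrite natrB ?(ltnW lt) // E subrr eqxx.
pose W i := \prod_(j in A :\ i) (m i - m j).
have W0 i : i \in A -> W i != 0.
  move=> iA; apply/prodf_neq0 => j; rewrite !inE subr_eq0 => /andP[ji jA].
  by apply: contraNneq ji => E; rewrite (mI _ _ jA iA (esym E)).
(* Test against the polynomial vanishing at all nodes except [m i] and [m j]: only two terms of the
   moment survive. *)
have eW i j : i \in A -> j \in A -> e i * W i = e j * W j.
  move=> iA jA; case: (eqVneq i j) => [->//|ij].
  pose h := \prod_(l in A :\ i :\ j) ('X - (m l)%:P).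
  have jAi : j \in A :\ i by rewrite !inE eq_sym ij.
  have iAj : i \in A :\ j by rewrite !inE ij.
  have := H h; rewrite size_prod_XsubC_in => /(_ _).
  rewrite {1}(cardsD1 i A) iA {1}(cardsD1 j (A :\ i)) jAi add1n ltnS => /(_ (leqnn _)).
  rewrite (bigD1 i) //= (bigD1 j) /=; last by rewrite jA eq_sym.
  rewrite big1 ?addr0; last first.
    move=> l /andP[/andP[lA li] lj]; rewrite horner_prod (bigD1 l) /=.
      by rewrite hornerXsubC subrr mul0r mulr0.
    by rewrite !inE lj li.
  have -> : W i = (m i - m j) * h.[m i].
    rewrite /W (bigD1 j) //= horner_prod; congr (_ * _).
    by apply: eq_big => [l|l _]; rewrite ?hornerXsubC // !inE andbC.
  have -> : W j = (m j - m i) * h.[m j].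
    rewrite /W (bigD1 i) //= horner_prod; congr (_ * _).
    by apply: eq_big => [l|l _]; rewrite ?hornerXsubC // !inE; case: (l == i); case: (l == j); case: (l \in A).
  move=> E; apply/eqP; rewrite -subr_eq0; apply/eqP.
  transitivity ((m i - m j) * (e i * h.[m i] + e j * h.[m j])); first by ring.
  by rewrite E mulr0.
pose pA := \prod_(i in P) ('X - (m i)%:P); pose pB := \prod_(i in N) ('X - (m i)%:P).
pose D := pA^`() * pB - pA * pB^`().
have [i0 i0A] : exists i, i \in A by apply/card_gt0P; lia.
pose c := e i0 * W i0.
have c0 : c != 0.
  rewrite mulf_neq0 ?W0 //; case: (e1 _ i0A) => ->; rewrite ?oppr_eq0 oner_neq0 //.
have derivat (B : {set I}) i : i \in B ->
    (\prod_(i in B) ('X - (m i)%:P)).[m i] = 0 /\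
    (\prod_(i in B) ('X - (m i)%:P))^`().[m i] = \prod_(j in B :\ i) (m i - m j).
  move=> iB; have -> : \prod_(i in B) ('X - (m i)%:P) =
      ('X - (m i)%:P) * \prod_(j in B | j != i) ('X - (m j)%:P) by rewrite (bigD1 i iB).
  rewrite horner_deriv_XsubC_mul hornerM hornerXsubC subrr mul0r; split=> //.
  rewrite horner_prod; apply: eq_big => [l|l _]; rewrite ?hornerXsubC // !inE andbC //.
(* At a root of [pA] only the first product in [D] survives, at a root of [pB] only the second; the
   sign between them is [e i]. *)
have DA i : i \in A -> D.[m i] = c.
  move=> iA; rewrite /c -(eW i i0) //.
  rewrite hornerD hornerN !hornerM /W (bigID (mem P)) /=.
  case: (boolP (i \in P)) => iP.
    have [-> ->] := derivat P i iP; rewrite mul0r subr0 (P1 i iP) mul1r horner_prod.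
    congr (_ * _); apply: eq_big => [j|j _]; rewrite ?hornerXsubC // !inE.
      by case: (j \in A); rewrite ?andbF ?andbT.
    case: (eqVneq j i) iP => [->|_] /=; first by rewrite inE => /andP[_ ->]; rewrite andbF.
    by case: (j \in A).
  have iN : i \in N by move: iP; rewrite !inE iA.
  have [-> ->] := derivat N i iN; rewrite mulr0 sub0r (N1 i iN) mulN1r horner_prod.
  congr (- (_ * _)); apply: eq_big => [j|j _]; rewrite ?hornerXsubC // !inE.
    case: (eqVneq j i) iN => [->|_] /=; first by rewrite inE => /andP[_ /negPf ->]; rewrite andbF.
    by case: (j \in A).
  by case: (j \in A); rewrite ?andbF ?andbT.
have sA : size pA = #|P|.+1 by exact: size_prod_XsubC_in.
have sB : size pB = #|P|.+1 by rewrite ePN; exact: size_prod_XsubC_in.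
have sdA : (size pA^`() <= #|P|)%N by rewrite -ltnS -sA lt_size_deriv // -size_poly_eq0 sA.
have sdB : (size pB^`() <= #|P|)%N by rewrite -ltnS -sB lt_size_deriv // -size_poly_eq0 sB.
have sD : (size D <= #|A|)%N.
  rewrite (leq_trans (size_polyD _ _)) // size_polyN geq_max.
  apply/andP; split; apply: (leq_trans (size_polyMleq _ _)); rewrite ?sA ?sB; lia.
have Dc : D = c%:P.
  apply: (poly_eq_on mI sD) => [|i iA]; last by rewrite hornerC DA.
  by rewrite (leq_trans (size_polyC_leq1 _)) //; lia.
(* [D] is also the Wronskian of [E] and [pB], and [E] has degree below [#|P|] since both products
   are monic of that degree. *)
pose E := pA - pB.
have DE : D = E^`() * pB - E * pB^`() by rewrite /D /E derivB; ring.
have lA : pA`_#|P| = 1 by have := monic_prod_XsubC (enum P) xpredT m; rewrite big_enum /= monicE lead_coefE -/pA sA => /eqP.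
have lB : pB`_#|P| = 1 by have := monic_prod_XsubC (enum N) xpredT m; rewrite big_enum /= monicE lead_coefE -/pB sB => /eqP.
have E0 : E != 0.
  apply: contraNneq c0 => E0; move: Dc; rewrite DE E0 deriv0 !mul0r subr0 => /esym/eqP.
  by rewrite polyC_eq0.
have sE : (size E <= #|P|)%N.
  apply/leq_sizeP => j; rewrite leq_eqVlt => /predU1P[<-|lt].
    by rewrite coefB lA lB subrr.
  by rewrite coefB !nth_default ?sA ?sB // subrr.
have sE0 : (0 < size E)%N by rewrite size_poly_gt0.
have [d sEd] : exists d, size E = d.+1 by case: (size E) sE0 => // d _; exists d.
(* This coefficient is nonzero, as [0 < #|P| - d <= #|A|]. But [X D = c X] has no term of degree
   [d + #|P|], which is at least 2. *)
have : ('X * D)`_(d + #|P|) = (d%:R - #|P|%:R) * E`_d.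
  have -> : 'X * D = ('X * E^`()) * pB - E * ('X * pB^`()) by rewrite DE; ring.
  rewrite coefB.
  rewrite !coefM_top ?coefXderiv ?(leq_trans (size_Xderiv _)) ?sEd ?sA ?sB //.
  by rewrite lB; ring.
have dlt : (d < #|P|)%N by rewrite -sEd.
rewrite Dc coefXM coefC; have -> : (d + #|P| == 0)%N = false by lia.
have -> : ((d + #|P|).-1 == 0)%N = false by lia.
move=> /esym/eqP; rewrite mulf_eq0 -oppr_eq0 opprB -natrB ?(ltnW dlt) //.
have -> : E`_d == 0 = false by rewrite -[d]/d.+1.-1 -sEd -lead_coefE lead_coef_eq0; apply/negbTE.
by rewrite orbF; apply/negP/chF; lia.
Qed.

(** * Additive characters and the Fourier expansion of [T] *)

(** A nontrivial unitary additive character: over a prime field, nontriviality amounts to the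
    trivial kernel required here. *)
Definition is_char (C : numClosedFieldType) (p : nat) (chi : 'F_p -> C) : Prop :=
  [/\ forall a b, chi (a + b) = chi a * chi b,
      forall a, (chi a == 1) = (a == 0) & forall a, `|chi a| = 1].

(** A root [w] of [1 + X + ... + X^(p-1)] is a primitive [p]-th root of unity, and [a] is sent to
    [w^a]. *)
Lemma exists_char (C : numClosedFieldType) (p : nat) :
  prime p -> exists chi : 'F_p -> C, is_char chi.
Proof.
move=> pp; have p1 := prime_gt1 pp.
pose Q : {poly C} := \poly_(i < p) 1.
have sQ : size Q = p by rewrite size_poly_eq ?oner_neq0.
have [w] : exists w, root Q w by apply/closed_rootP; rewrite sQ; lia.
rewrite rootE horner_poly => /eqP Qw.
have wp : w ^+ p = 1.
  apply/eqP; rewrite -subr_eq0 subrX1 (_ : \sum_(i < p) w ^+ i = 0) ?mulr0 //.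
  by rewrite -[RHS]Qw; apply: eq_bigr => i _; rewrite mul1r.
have w1 : w != 1.
  apply: contraTneq isT => w1; move: Qw; rewrite w1.
  under eq_bigr do rewrite mul1r expr1n.
  rewrite sumr_const card_ord => /eqP; rewrite pnatr_eq0; lia.
have Nw : `|w| = 1.
  apply/eqP; rewrite -(pexpr_eq1 (n := p)) ?normr_ge0 -?normrX ?wp ?normr1 //; lia.
exists (fun a : 'F_p => w ^+ (a : nat)); split=> [a b|a|a].
- rewrite -exprD -[RHS](expr_mod _ wp) /=; congr (w ^+ (_ %% _)); exact: Fp_cast.
- have [m mw mp] := prim_order_exists (prime_gt0 pp) wp.
  have /primeP[_ /(_ m mp) /pred2P[m1|{}mp]] := pp.
    by move: (prim_expr_order mw) w1; rewrite m1 expr1 => ->; rewrite eqxx.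
  rewrite mp in mw; rewrite -(prim_order_dvd mw).
  have ap : (a < p)%N by rewrite -[X in (_ < X)%N](Fp_cast pp).
  have -> : (a == 0) = (a == 0 :> nat) by [].
  case: eqVneq => [->|a0]; first by rewrite dvdn0.
  by rewrite gtnNdvd // lt0n.
- by rewrite normrX Nw expr1n.
Qed.

Lemma char0 (C : numClosedFieldType) (p : nat) (chi : 'F_p -> C) :
  is_char chi -> chi 0 = 1.
Proof. by case=> _ h _; apply/eqP; rewrite h. Qed.

Lemma char_sum (C : numClosedFieldType) (p : nat) (chi : 'F_p -> C) (I : Type)
    (r : seq I) (P : pred I) (a : I -> 'F_p) :
  is_char chi -> chi (\sum_(i <- r | P i) a i) = \prod_(i <- r | P i) chi (a i).
Proof. by move=> h; have [hD _ _] := h; apply: big_morph => //; exact: char0. Qed.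

Lemma charN (C : numClosedFieldType) (p : nat) (chi : 'F_p -> C) (a : 'F_p) :
  is_char chi -> chi (- a) = (chi a)^*.
Proof.
move=> h; have [hD _ h1] := h.
have u : chi a != 0 by rewrite -normr_eq0 h1 oner_neq0.
apply: (mulfI u); rewrite -hD subrr (char0 h) -normCK h1 expr1n //.
Qed.

(** Orthogonality of characters: outside the row space, translating by a solution on which the
    character is not 1 multiplies the sum by a scalar other than 1. *)
Lemma sol_char_sum (C : numClosedFieldType) (p m t n : nat) (chi : 'F_p -> C)
    (M : 'M['F_p]_(m, t)) (U : 'M['F_p]_(n, t)) :
  is_char chi ->
  \sum_(x in sol M n) chi (\tr (U *m x)) =
  if (U <= M)%MS then #|sol M n|%:R else 0.
Proof.
move=> h; have [hD h0 _] := h.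
case: ifPn => UM.
  rewrite -sum1_card natr_sum; apply: eq_bigr => x; rewrite inE => /eqP Mx.
  by case/submxP: UM => B ->; rewrite -mulmxA Mx mulmx0 mxtrace0 (char0 h).
have /existsP[i /existsP[j Uij]] :
    [exists i, [exists j, (U *m cokermx M) i j != 0]].
  apply: contraNT UM => H; rewrite submxE; apply/eqP/matrixP => i j.
  rewrite [RHS]mxE; apply/eqP; apply: contraNT H => H.
  by apply/existsP; exists i; apply/existsP; exists j.
(* Column [j] of the cokernel is placed in column [i], so that the trace of [U *m y] is the nonzero
   entry [Uij]. *)
pose y : 'M['F_p]_(t, n) := cokermx M *m delta_mx j i.
have yS : y \in sol M n by rewrite inE mulmxA mulmx_coker mul0mx.
have cy : chi (\tr (U *m y)) != 1.
  rewrite h0 mulmxA; set V := U *m _ in Uij *.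
  have E l : (delta_mx j i *m V) l l = (l == j)%:R * V i l.
    rewrite mxE (bigD1 i) //= big1 ?addr0 => [|q qi]; first by rewrite mxE eqxx andbT.
    by rewrite mxE (negPf qi) andbF mul0r.
  rewrite mxtrace_mulC /mxtrace (bigD1 j) //= big1 => [|l lj].
    by rewrite E eqxx mul1r addr0.
  by rewrite E (negPf lj) mul0r.
set s0 := \sum_(x in _) _.
have : chi (\tr (U *m y)) * s0 = s0.
  rewrite /s0 [RHS](reindex_inj (addrI y)) big_distrr /=.
  apply: eq_big => [x|x _]; last by rewrite mulmxDr mxtraceD hD.
  by rewrite !inE mulmxDr; move: yS; rewrite inE => /eqP ->; rewrite add0r.
move/eqP; rewrite -subr_eq0 -{2}[s0]mul1r -mulrBl mulf_eq0 subr_eq0 (negPf cy).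
by move/eqP.
Qed.

Definition fourier (C : numClosedFieldType) (p n : nat) (chi : 'F_p -> C)
    (H : 'cV['F_p]_n -> C) (x : 'rV['F_p]_n) : C :=
  \sum_u H u * chi ((x *m u) 0 0).

(** Expanding the product gives a sum over [t]-tuples of frequencies, read as the columns of [U].
    Their joint phase at [x] is the trace of [U *m x], and orthogonality selects the row space. *)
Lemma T_fourier (C : numClosedFieldType) (p m t n : nat) (chi : 'F_p -> C)
    (M : 'M['F_p]_(m, t)) (H : 'cV['F_p]_n -> C) :
  is_char chi ->
  T M (fourier chi H) =
  \sum_(U : 'M['F_p]_(n, t) | (U <= M)%MS) \prod_i H (col i U).
Proof.
move=> h; rewrite /T /fourier.
have S0 : #|sol M n|%:R != 0 :> C.
  by rewrite pnatr_eq0 -lt0n; apply/card_gt0P; exists 0; rewrite inE mulmx0.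
apply: (canLR (mulfK S0)).
under eq_bigr do rewrite bigA_distr_bigA /=.
rewrite exchange_big /=.
rewrite (reindex (fun U : 'M['F_p]_(n, t) => [ffun i => col i U])) /=; last first.
  exists (fun f : {ffun 'I_t -> 'cV['F_p]_n} => \matrix_(i, j) f j i 0) => [U _|f _].
    by apply/matrixP => i j; rewrite mxE ffunE mxE.
  by apply/ffunP => i; rewrite ffunE; apply/colP => j; rewrite !mxE.
rewrite big_distrl [RHS]big_mkcond /=; apply: eq_bigr => U _.
transitivity ((\prod_i H (col i U)) * \sum_(x in sol M n) chi (\tr (U *m x))).
  rewrite big_distrr; apply: eq_bigr => x _.
  rewrite big_split /=; congr (_ * _).
    by apply: eq_bigr => i _; rewrite ffunE.
  rewrite mxtrace_mulC /mxtrace (char_sum _ _ _ h); apply: eq_bigr => i _; congr chi.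
  by rewrite !mxE; apply: eq_bigr => j _; rewrite ffunE !mxE.
by rewrite sol_char_sum //; case: ifP; rewrite // mulr0.
Qed.

(** * Expansion around the constant [1/2] *)

Definition col_weight (p n t : nat) (U : 'M['F_p]_(n, t)) : nat :=
  #|[pred i | col i U != 0]|.

Lemma col_weight_eq0 (p n t : nat) (U : 'M['F_p]_(n, t)) :
  (col_weight U == 0%N) = (U == 0).
Proof.
apply/idP/eqP => [/eqP/card0_eq H|->].
  apply/matrixP => i j; move: (H j); rewrite !inE => /negbFE/eqP/colP/(_ i).
  by rewrite !mxE.
by apply/eqP/eq_card0 => i; rewrite !inE col0 eqxx.
Qed.

Lemma s_le_eq_length (p m t : nat) (M : 'M['F_p]_(m, t)) (u : 'rV['F_p]_t) :
  u != 0 -> (u <= M)%MS -> (s M <= eq_length u)%N.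
Proof.
move=> u0 uM; rewrite /s; move: (mem_index_enum u).
elim: (index_enum _) => // v r IH; rewrite inE big_cons => /predU1P[<-|/IH {}IH].
  by rewrite u0 uM geq_minl.
by case: ifP => // _; rewrite geq_min IH orbT.
Qed.

(** A nonzero row of [U] is an equation of the system, supported on the nonzero columns of [U]. *)
Lemma s_le_col_weight (p m t n : nat) (M : 'M['F_p]_(m, t)) (U : 'M['F_p]_(n, t)) :
  U != 0 -> (U <= M)%MS -> (s M <= col_weight U)%N.
Proof.
move=> U0 UM; have [i Ui] : exists i, row i U != 0.
  apply/existsP; apply: contraNT U0 => H; apply/eqP/row_matrixP => i.
  by rewrite row0; apply/eqP; apply: contraNT H => H; apply/existsP; exists i.
apply: leq_trans (s_le_eq_length Ui (submx_trans (row_sub i U) UM)) _.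
apply: subset_leq_card; apply/subsetP => j; rewrite !inE mxE.
by apply: contraNneq => /colP/(_ i); rewrite !mxE => ->.
Qed.

(** The bound with [L] will keep [1/2 + e g] in [[0, 1]]; the bound with [K] will make the error
    term smaller than the main term. *)
Lemma exists_small (R : realType) (A K L : R) : 0 < A -> 0 <= K -> 0 <= L ->
  exists e : R, [/\ 0 < e, e <= 1, e * L <= 2^-1 & e * K < A].
Proof.
move=> A0 K0 L0.
pose D := 2 * (A + 1) * (K + L + 1).
have D0 : 0 < D by rewrite /D !mulr_gt0 //; lra.
exists (A / D); split.
- by rewrite divr_gt0.
- rewrite ler_pdivrMr // mul1r /D; nra.
- rewrite mulrAC ler_pdivrMr // /D; nra.
- rewrite mulrAC ltr_pdivrMr // /D; nra.
Qed.

(** The constant [1/2] is the transform of a mass at frequency 0. As [G 0 = 0], zero columns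
    contribute [1/2] and nonzero columns [e * G]. *)
Lemma T_scaled_fourier (C : numClosedFieldType) (p m t n : nat) (chi : 'F_p -> C)
    (M : 'M['F_p]_(m, t)) (G : 'cV['F_p]_n -> C) (e : C) :
  is_char chi -> G 0 = 0 ->
  T M (fun x => 2^-1 + e * fourier chi G x) =
  \sum_(U : 'M['F_p]_(n, t) | (U <= M)%MS)
    2^-1 ^+ (t - col_weight U) * e ^+ col_weight U *
      \prod_(i | col i U != 0) G (col i U).
Proof.
move=> h G0; pose H u := (u == 0)%:R / 2 + e * G u.
transitivity (T M (fourier chi H)).
  rewrite /T; congr (_ / _); apply: eq_bigr => x _; apply: eq_bigr => i _.
  rewrite /fourier /H; under [RHS]eq_bigr do rewrite mulrDl -mulrA.
  rewrite big_split /= -big_distrr /=; congr (_ + _).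
  rewrite (bigD1 0) //= mulmx0 mxE (char0 h) eqxx mul1r mulr1 big1 ?addr0 //.
  by move=> u /negPf ->; rewrite !mul0r.
rewrite T_fourier //; apply: eq_bigr => U _.
rewrite (bigID (fun i => col i U != 0)) /= mulrC.
have -> : \prod_(i | ~~ (col i U != 0)) H (col i U) = 2^-1 ^+ (t - col_weight U).
  rewrite -[X in (X - _)%N]card_ord -(cardC [pred i | col i U != 0]) addKn.
  rewrite -prodr_const; apply: eq_big => [i|i]; first by rewrite !inE.
  by move=> /negbNE/eqP ->; rewrite /H G0 eqxx mulr0 addr0 mul1r.
rewrite -mulrA -prodr_const -big_split; congr (_ * _).
by apply: eq_bigr => i /negPf ci; rewrite /H ci mul0r add0r.
Qed.

Lemma eq_T (C : numFieldType) (p m t n : nat) (M : 'M['F_p]_(m, t))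
    (f g : 'rV['F_p]_n -> C) : f =1 g -> T M f = T M g.
Proof.
by move=> fg; congr (_ / _); apply: eq_bigr => x _; apply: eq_bigr => i _.
Qed.

Lemma T_complex (R : realType) (p m t n : nat) (M : 'M['F_p]_(m, t))
    (f : 'rV['F_p]_n -> R) :
  (T M f)%:C%C = T M (fun x => (f x)%:C%C).
Proof.
rewrite /T rmorphM fmorphV rmorph_nat rmorph_sum /=.
by congr (_ / _); apply: eq_bigr => x _; rewrite rmorph_prod.
Qed.

Lemma fourier_real (R : realType) (p n : nat) (chi : 'F_p -> R[i])
    (G : 'cV['F_p]_n -> R[i]) :
  is_char chi -> (forall u, G (- u) = (G u)^*) ->
  exists g : 'rV['F_p]_n -> R, forall x, (g x)%:C%C = fourier chi G x.
Proof.
move=> h GN; exists (fun x => complex.Re (fourier chi G x)) => x.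
apply: RRe_real; rewrite CrealE /fourier rmorph_sum /=.
rewrite (reindex_inj oppr_inj); apply/eqP; apply: eq_bigr => u _ /=.
by rewrite rmorphM /= GN conjCK mulmxN mxE (charN _ h) conjCK.
Qed.

(** Odd weights cancel between [E] and [- E]. Nonzero weights below [k] can only be [k - 1], which
    is odd; weights above [k] are bounded through [E <= 1]. *)
Lemma two_colouring_expansion (C : numClosedFieldType) (p m t n k : nat)
    (M : 'M['F_p]_(m, t)) (b : 'M['F_p]_(n, t) -> C) (E : C) :
  (0 < k)%N -> ~~ odd k -> s M = k.-1 -> b 0 = 1 -> 0 <= E <= 1 ->
  let cf U := 2^-1 ^+ (t - col_weight U) * b U in
  `|\sum_(U : 'M['F_p]_(n, t) | (U <= M)%MS)
      (E ^+ col_weight U + (- E) ^+ col_weight U) * cf U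
    - (2 * 2^-1 ^+ t + 2 * E ^+ k * (2^-1 ^+ (t - k) *
        \sum_(U : 'M['F_p]_(n, t) | (U <= M)%MS && (col_weight U == k)) b U))|
  <= 2 * E ^+ k.+1 * \sum_(U : 'M['F_p]_(n, t)) `|cf U|.
Proof.
move=> k0 kev sM b0 /andP[E0 E1]; set cf := fun U => _; cbv zeta.
pose term U := (E ^+ col_weight U + (- E) ^+ col_weight U) * cf U.
pose rest := \sum_(U : 'M['F_p]_(n, t) | [&& (U <= M)%MS, U != 0 & col_weight U != k]) term U.
rewrite [X in `|X|](_ : _ = rest); last first.
  apply/eqP; rewrite subr_eq addrC; apply/eqP.
  rewrite (bigD1 0) ?sub0mx //= (bigID (fun U => col_weight U == k)) /= addrA.
  congr (_ + _ + _); last by apply: eq_bigl => U; rewrite andbA.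
    rewrite /cf b0 (_ : col_weight 0 = 0%N); last by apply/eqP; rewrite col_weight_eq0.
    by rewrite !expr0 subn0 mulr1.
  rewrite !big_distrr /=; apply: eq_big => [U|U /andP[_ /eqP wk]].
    rewrite -andbA; congr (_ && _).
    case: (col_weight U =P k) => [wk|]; rewrite ?andbF // andbT.
    by rewrite -col_weight_eq0 wk -lt0n.
  by rewrite /cf wk exprNn -signr_odd (negPf kev) expr0 mul1r; ring.
rewrite big_distrr /= (le_trans (ler_norm_sum _ _ _)) //.
rewrite [X in X <= _]big_mkcond /=; apply: ler_sum => U _.
case: ifP => [/and3P[UM U0 wk]|_]; last by rewrite !mulr_ge0 ?exprn_ge0.
rewrite /term normrM; have := s_le_col_weight U0 UM; rewrite sM => kw.
rewrite ler_wpM2r //; case: (boolP (odd (col_weight U))) => od.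
  by rewrite exprNn -signr_odd od mulN1r subrr normr0 mulr_ge0 ?exprn_ge0.
rewrite exprNn -signr_odd (negPf od) expr0 mul1r -mulr2n -[_ *+ 2]mulr_natl normrM normr_nat.
rewrite ler_wpM2l // ger0_norm ?exprn_ge0 // ler_wiXn2l //.
rewrite ltn_neqAle eq_sym wk /=; case: (ltngtP (col_weight U) k) => // wk'.
have wE : col_weight U = k.-1 by lia.
by move: od; rewrite wE; case: (k) k0 kev => // k' _ /=; rewrite negbK => ->.
Qed.

(** The hypothesis with [c] expresses negativity of a sum living in the complex numbers; that the
    sum is real follows from the symmetry [U -> - U]. *)
Lemma uncommon_of_leading_term (R : realType) (p m t n k : nat)
    (M : 'M['F_p]_(m, t)) (chi : 'F_p -> R[i]) (G : 'cV['F_p]_n -> R[i]) (c : R[i]) :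
  is_char chi -> (0 < n)%N -> (0 < k)%N -> ~~ odd k -> s M = k.-1 ->
  G 0 = 0 -> (forall u, G (- u) = (G u)^*) ->
  `|\sum_(U : 'M['F_p]_(n, t) | (U <= M)%MS && (col_weight U == k))
      \prod_(i | col i U != 0) G (col i U) + c| < c ->
  uncommon R M.
Proof.
move=> h n0 k0 kev sM G0 GN.
set F := \sum_(U | _) _ => Fc.
pose b (U : 'M['F_p]_(n, t)) := \prod_(i | col i U != 0) G (col i U).
have bN U : b (- U) = (b U)^*.
  rewrite /b rmorph_prod /=; apply: eq_big => [i|i _]; last first.
    by rewrite -GN; congr G; apply/colP => j; rewrite !mxE.
  by rewrite -oppr_eq0; congr (_ != 0); apply/colP => j; rewrite !mxE opprK.
have colN (U : 'M['F_p]_(n, t)) i : (col i (- U) == 0) = (col i U == 0).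
  by rewrite -[RHS]oppr_eq0; congr (_ == 0); apply/colP => j; rewrite !mxE.
have Freal : F \is Num.real.
  rewrite CrealE /F rmorph_sum (reindex_inj oppr_inj) /=; apply/eqP.
  apply: eq_big => [U|U _]; last by rewrite -/(b _) bN conjCK.
  by rewrite (eqmx_opp U); congr (_ && (_ == k)); apply: eq_card => i; rewrite !inE colN.
have F0 : F < 0.
  have cR : c \is Num.real by rewrite ger0_real // ltW // (le_lt_trans _ Fc).
  by rewrite -(ltrD2r c) add0r (le_lt_trans _ Fc) // real_ler_norm // rpredD.
have [g gE] := fourier_real h GN.
pose cf (U : 'M['F_p]_(n, t)) : R[i] := 2^-1 ^+ (t - col_weight U) * b U.
have [K KE] : exists K, \sum_(U : 'M['F_p]_(n, t)) `|cf U| = K%:C%C.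
  by apply/complex_realP; rewrite rpred_sum // => U _; rewrite normr_real.
have [A AE] : exists A, - (2^-1 ^+ (t - k) * F) = A%:C%C.
  by apply/complex_realP; rewrite rpredN rpredM // rpredX // rpredV rpred_nat.
have K0 : 0 <= K by rewrite -lecR -KE sumr_ge0.
have A0 : 0 < A.
  by rewrite -ltcR -AE oppr_gt0 pmulr_rlt0 // exprn_gt0 // invr_gt0 ltr0n.
have [e [e0 e1 eL eK]] := exists_small A0 K0 (L := \sum_x `|g x|) (sumr_ge0 _ (fun x _ => normr_ge0 _)).
have eg x : - 2^-1 <= e * g x <= 2^-1.
  rewrite -ler_norml normrM (gtr0_norm e0) (le_trans _ eL) // ler_pM2l //.
  by rewrite (bigD1 x) //= lerDl sumr_ge0.
move=> /(_ n (fun x => 2^-1 + e * g x) n0) H.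
have {}H := H (fun x => ltac:(have := eg x; lra)).
set tau := T M _ + _ in H.
pose E := e%:C%C : R[i].
pose term U := (E ^+ col_weight U + (- E) ^+ col_weight U) * cf U.
have tauE : tau%:C%C = \sum_(U : 'M['F_p]_(n, t) | (U <= M)%MS) term U.
  rewrite /tau rmorphD /= !T_complex.
  rewrite (eq_T M (g := fun x => 2^-1 + E * fourier chi G x)); last first.
    by move=> x; rewrite -gE rmorphD fmorphV rmorph_nat rmorphM.
  rewrite [X in _ + X](eq_T M (g := fun x => 2^-1 + (- E) * fourier chi G x)); last first.
    move=> x; rewrite -gE rmorphB rmorphD fmorphV rmorph_nat rmorphM rmorph1 /= -/E.
    by rewrite mulNr opprD addrA; congr (_ - _); field.
  rewrite !T_scaled_fourier // -big_split; apply: eq_bigr => U _.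
  by rewrite /term /cf /b /= -mulrDl -mulrDr -mulrA mulrCA.
have Eb : 0 <= E <= 1 by rewrite lecR (ltW e0) -[1]/(1%:C%C) lecR.
have b0 : b 0 = 1 by rewrite /b big_pred0 // => i; rewrite col0 eqxx.
have le2 := two_colouring_expansion k0 kev sM b0 Eb.
have z_le : tau - (2 * 2^-1 ^+ t - 2 * e ^+ k * A) <= 2 * e ^+ k.+1 * K.
  have {}le2 : `|tau%:C%C - (2 * 2^-1 ^+ t + 2 * E ^+ k * - A%:C%C)|
      <= 2 * E ^+ k.+1 * K%:C%C by rewrite -KE tauE -AE opprK.
  rewrite -lecR.
  have zE : (tau - (2 * 2^-1 ^+ t - 2 * e ^+ k * A))%:C%C =
      tau%:C%C - (2 * 2^-1 ^+ t + 2 * E ^+ k * - A%:C%C).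
    by rewrite !(rmorphB, rmorphM, rmorphXn, fmorphV, rmorph_nat) /= mulrN.
  have -> : (2 * e ^+ k.+1 * K)%:C%C = 2 * E ^+ k.+1 * K%:C%C.
    by rewrite !(rmorphM, rmorphXn, rmorph_nat).
  rewrite (le_trans (real_ler_norm _)) //; first by apply/complex_realP; eexists.
  by rewrite zE.
have tE : 2 ^ (1 - t%:Z) = 2 * 2^-1 ^+ t :> R.
  by rewrite expfzDr ?pnatr_eq0 // expr1z exprVn -exprnN.
move: H; rewrite tE => H.
(* The estimate reads [tau - 2^(1-t) <= 2 e^k (e K - A) < 0], against commonness. *)
have := ltr_pM2l (exprn_gt0 k e0) (e * K) A; rewrite eK => H2.
move: z_le H2; rewrite exprS; set P := e ^+ k; nra.
Qed.

(** * Dominant terms in sums of [N]-th powers *)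

(** Bernoulli's inequality applied to [x = 1 / (1 + y)]. *)
Lemma expr_small (R : realType) (x e : R) :
  0 <= x < 1 -> 0 < e -> exists N, forall n, (N <= n)%N -> x ^+ n < e.
Proof.
move=> /andP[x0 x1] e0; case: (eqVneq x 0) => [->|xn0].
  by exists 1%N => -[//|n] _; rewrite expr0n.
have {xn0}x0 : 0 < x by rewrite lt_def xn0.
have [y y0 xE] : exists2 y, 0 < y & x = (1 + y)^-1.
  by exists (x^-1 - 1); [rewrite subr_gt0 invf_gt1 | rewrite addrC subrK invrK].
have ey0 : 0 < (e * y)^-1 by rewrite invr_gt0 mulr_gt0.
exists (Num.bound (e * y)^-1) => n Nn.
have bern k : 1 + k%:R * y <= (1 + y) ^+ k.
  elim: k => [|k IH]; first by rewrite mul0r addr0 expr0.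
  rewrite exprS (le_trans _ (ler_wpM2l _ IH)) ?addr_ge0 ?ler01 ?(ltW y0) //.
  rewrite -natr1; have : 0 <= k%:R :> R by []; nra.
have ny : (e * y)^-1 < n%:R.
  by rewrite (lt_le_trans (archi_boundP (ltW ey0))) // ler_nat.
have {}ny : 1 < n%:R * (e * y) by rewrite -ltr_pdivrMr ?mulr_gt0 // div1r.
rewrite xE exprVn -div1r ltr_pdivrMr ?exprn_gt0 ?addr_gt0 //.
rewrite (lt_le_trans _ (ler_wpM2l (ltW e0) (bern n))) //; nra.
Qed.

Lemma geometric_dominated (R : realType) (a z q d : R[i]) :
  `|z| < q -> 0 < d -> exists N, forall n, (N <= n)%N -> `|a * z ^+ n| <= d * q ^+ n.
Proof.
move=> zq d0; have q0 : 0 < q by exact: le_lt_trans zq.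
have [x xE] : exists x, `|z| / q = x%:C%C.
  by apply/complex_realP; rewrite ger0_real // divr_ge0 // ltW.
have [e eE] : exists e, d / (`|a| + 1) = e%:C%C.
  by apply/complex_realP; rewrite gtr0_real // divr_gt0 // ltr_wpDl.
have x01 : 0 <= x < 1.
  rewrite -lecR -ltcR -xE divr_ge0 ?(ltW q0) //= ltr_pdivrMr // mul1r //.
have e0 : 0 < e by rewrite -ltcR -eE divr_gt0 // ltr_wpDl.
have [N HN] := expr_small x01 e0; exists N => n /HN; rewrite -ltcR rmorphXn /= -xE -eE.
rewrite expr_div_n ltr_pdivrMr ?exprn_gt0 // => H.
rewrite normrM normrX (le_trans (ler_wpM2l _ (ltW H))) // mulrA ler_wpM2r ?exprn_ge0 ?(ltW q0) //.
rewrite mulrCA ler_piMr ?(ltW d0) // ler_pdivrMr ?ltr_wpDl // mul1r lerDl //.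
Qed.

(* The summands equal to [- q ^+ N] win over the geometrically smaller ones. *)
Lemma power_sum_dominated (R : realType) (I : finType) (P : pred I)
    (a z : I -> R[i]) (q : R[i]) (i0 : I) :
  0 < q ->
  (forall i, P i -> [\/ a i = 0, `|z i| < q | z i = q /\ a i = -1]) ->
  P i0 -> z i0 = q -> a i0 = -1 ->
  exists N (c : R[i]), `|\sum_(i | P i) a i * z i ^+ N + c| < c.
Proof.
move=> q0 H Pi0 zi0 ai0.
(* With this [d], the at most [#|I|] dominated summands add up to strictly less than one
   [q ^+ K]. *)
pose d : R[i] := (#|I|.+1)%:R^-1.
have d0 : 0 < d by rewrite invr_gt0 ltr0n.
have /fin_all_exists[N HN] i : exists N, forall n, (N <= n)%N ->
    `|z i| < q -> `|a i * z i ^+ n| <= d * q ^+ n.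
  case: (boolP (`|z i| < q)) => [zq|_]; last by exists 0%N.
  by have [N HN] := geometric_dominated (a i) zq d0; exists N => n /HN.
pose K := \max_i N i; exists K.
pose good i := (z i == q) && (a i == -1).
(* This [c] cancels the good summands exactly, and is at least [q ^+ K] thanks to [i0]. *)
exists (\sum_(i | P i && good i) q ^+ K).
rewrite (bigID good) /= -addrA [X in _ + X]addrC addrA -big_split /= big1 ?add0r; last first.
  by move=> i /andP[_ /andP[/eqP -> /eqP ->]]; rewrite mulN1r addNr.
apply: (@lt_le_trans _ _ (q ^+ K)); last first.
  by rewrite (bigD1 i0) ?Pi0 /good ?zi0 ?ai0 ?eqxx //= lerDl sumr_ge0 // => i _; rewrite exprn_ge0 // ltW.
have qK : 0 < q ^+ K by rewrite exprn_gt0.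
apply: (@le_lt_trans _ _ (\sum_(i : I) d * q ^+ K)); last first.
  rewrite sumr_const -mulr_natl mulrA gtr_pMl // /d ltr_pdivrMr ?ltr0n // mul1r ltr_nat //.
rewrite (le_trans (ler_norm_sum _ _ _)) // big_mkcond /=; apply: ler_sum => i _.
case: ifP => [/andP[Pi ng]|_]; last by rewrite mulr_ge0 // ltW.
case: (H i Pi) => [->|zq|[zq ai]].
- by rewrite mul0r normr0 mulr_ge0 // ltW.
- by apply: HN => //; rewrite /K leq_bigmax.
- by move: ng; rewrite /good zq ai !eqxx.
Qed.

(** * Signed sums of shifted powers *)

Lemma coef_linear_exp (F : fieldType) (r s : F) (d : nat) :
  (size ((r *: 'X + s%:P) ^+ d)%R <= d.+1)%N /\ ((r *: 'X + s%:P) ^+ d)`_d = r ^+ d.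
Proof.
have sl : (size (r *: 'X + s%:P)%R <= 2)%N.
  by apply/leq_sizeP => -[|[|i]] // _; rewrite !coefE mulr0 addr0.
elim: d => [|d [IHs IHc]]; first by rewrite !expr0 size_poly1 coef1.
rewrite exprS; split.
  by rewrite (leq_trans (size_polyMleq _ _)) //; move: sl IHs; lia.
by rewrite -add1n coefM_top // IHc !coefE mulr1 addr0 exprS.
Qed.

(** As a polynomial in [r] the sum has degree below [p], so vanishing everywhere makes it zero.
    Repeated differentiation lowers the exponent, and evaluation at 0 gives all moments excluded by
    [signed_moments_nonzero]. *)
Lemma signed_powers_nonzero (p : nat) (I : finType) (A : {set I})
    (m e : I -> 'F_p) :
  prime p -> (3 < #|A|)%N -> ~~ odd #|A| -> {in A &, injective m} ->
  (forall i, i \in A -> e i = 1 \/ e i = -1) ->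
  ~ (forall r, \sum_(i in A) e i * (r + m i) ^+ (#|A| - 2) = 0).
Proof.
move=> pp A3 Aev mI e1 H.
(* Distinct [m i] give [#|A| <= p]; equality is excluded because [#|A|] is even and exceeds 2. *)
have Ap : (#|A| < p)%N.
  have : (#|A| <= p)%N.
    by rewrite -(card_in_imset mI) -[X in (_ <= X)%N](card_Fp pp) max_card.
  rewrite leq_eqVlt => /predU1P[Ap|//].
  by move: A3 Aev; rewrite Ap; case: (even_prime pp) => ->.
have chF n : (0 < n < p)%N -> n%:R != 0 :> 'F_p.
  move=> /andP[n0 np]; rewrite -(dvdn_pcharf (pchar_Fp pp)) gtnNdvd //.
pose Q n : {poly 'F_p} := \sum_(i in A) e i *: ('X + (m i)%:P) ^+ n.
have Qd : Q (#|A| - 2)%N = 0.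
  apply: (@roots_geq_poly_eq0 _ _ (enum 'F_p)).
  - apply/allP => r _; rewrite rootE horner_sum -[X in _ == X](H r); apply/eqP.
    by apply: eq_bigr => i _; rewrite hornerZ horner_exp hornerD hornerX hornerC.
  - exact: enum_uniq.
  rewrite -cardE card_Fp // (leq_trans (size_sum _ _ _)) //; apply/bigmax_leqP => i _.
  rewrite (leq_trans (size_scale_leq _ _)) //.
  have [sl _] := coef_linear_exp 1 (m i) (#|A| - 2); rewrite scale1r in sl.
  by apply: (leq_trans sl); lia.
have Q0 n : (n <= #|A| - 2)%N -> Q n = 0.
  (* Downward induction from [#|A| - 2]: the derivative of [Q n'.+1] is [n'.+1] times [Q n'], with
     an invertible factor. *)
  move=> /subKn <-; elim: (_ - n)%N (leq_subr n (#|A| - 2)) => [|l IH] ll.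
    by rewrite subn0.
  have := IH (ltnW ll); have -> : (#|A| - 2 - l = (#|A| - 2 - l.+1).+1)%N by lia.
  set n' := (_ - l.+1)%N => /(congr1 (fun g => deriv g)).
  rewrite deriv0 /Q raddf_sum /=.
  under eq_bigr => i _ do rewrite derivZ deriv_exp derivD derivX derivC addr0 mul1r /=.
  move=> E; apply: (scalerI (chF n'.+1 _)); first by rewrite /n'; lia.
  rewrite scaler0 -[RHS]E scaler_sumr; apply: eq_bigr => i _.
  by rewrite scalerA mulrC -scalerA scaler_nat.
apply: (signed_moments_nonzero A3 Aev _ mI e1) => [n /andP[n0 nA]|h sh].
  by rewrite chF // n0 (leq_ltn_trans nA).
under eq_bigr do rewrite horner_coef big_distrr.
rewrite exchange_big big1 //= => n _.
have nA : (n.+1 < #|A|)%N := leq_ltn_trans (ltn_ord n) sh.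
have /(congr1 (fun g => h`_n * g.[0])) := Q0 n ltac:(by rewrite leq_subRL; lia).
rewrite horner0 mulr0 horner_sum big_distrr /= => E.
rewrite -[RHS]E; apply: eq_bigr => i _.
by rewrite hornerZ horner_exp hornerD hornerX hornerC add0r mulrCA.
Qed.

(** * Codewords of small support and the power relation *)

Lemma exists_perp (F : fieldType) (v : 'cV[F]_2) :
  exists2 l : 'rV_2, l != 0 & l *m v = 0.
Proof.
have : kermx v != 0.
  rewrite -mxrank_eq0 mxrank_ker subn_eq0 -ltnNge ltnS; exact: rank_leq_col.
by case/rowV0Pn => l /sub_kermxP lv l0; exists l.
Qed.

Lemma exists_dual (F : fieldType) (v : 'cV[F]_2) :
  v != 0 -> exists l : 'rV_2, (l *m v) 0 0 = 1.
Proof.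
move=> v0; have [i vi] : exists i, v i 0 != 0.
  apply/existsP; apply: contraNT v0 => H; apply/eqP/colP => i; rewrite mxE.
  by apply/eqP; apply: contraNT H => H; apply/existsP; exists i.
exists ((v i 0)^-1 *: delta_mx 0 i).
by rewrite -scalemxAl -rowE !mxE mulVf.
Qed.

(** Two zeros inside [S] leave a support of size at most [#|S| - 2], which is below [s M]. *)
Lemma codeword_eq0 (p m t : nat) (M : 'M['F_p]_(m, t)) (S : {set 'I_t})
    (c : 'rV['F_p]_t) (i j : 'I_t) :
  (#|S| <= (s M).+1)%N -> (c <= M)%MS -> (forall l, l \notin S -> c 0 l = 0) ->
  i \in S -> j \in S -> i != j -> c 0 i = 0 -> c 0 j = 0 -> c = 0.
Proof.
move=> Ss cM cS iS jS ij ci cj; apply/eqP; apply: contraLR Ss => c0.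
rewrite -ltnNge (cardsD1 i) iS (cardsD1 j) !inE jS eq_sym ij !add1n !ltnS.
apply: leq_trans (s_le_eq_length c0 cM) _; apply: subset_leq_card.
apply/subsetP => l; rewrite !inE => cl.
have -> : l != j by apply: contraNneq cl => ->; rewrite cj.
have -> : l != i by apply: contraNneq cl => ->; rewrite ci.
by apply: contraR cl => /cS ->; rewrite eqxx.
Qed.

Lemma mulmx_col (F : fieldType) (n k : nat) (A : 'M[F]_(n, k)) (l : 'rV_n) (j : 'I_k) :
  (l *m col j A) 0 0 = (l *m A) 0 j.
Proof. by rewrite colE mulmxA -colE mxE. Qed.

(** Dual form of the linear independence of any two columns of [Psi]. *)
Lemma two_zeros_eq0 (p k : nat) (Psi : 'M['F_p]_(2, k)) (l : 'rV['F_p]_2) (i j : 'I_k) :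
  (k <= (s Psi).+1)%N -> row_free Psi -> i != j ->
  (l *m Psi) 0 i = 0 -> (l *m Psi) 0 j = 0 -> l = 0.
Proof.
move=> ks fr ij li lj; apply/(row_free_inj fr); rewrite mul0mx.
apply: (@codeword_eq0 _ _ _ Psi setT _ i j); rewrite ?inE ?submxMl //.
  by rewrite cardsT card_ord.
by move=> h; rewrite inE.
Qed.

Lemma col_neq0 (p k : nat) (Psi : 'M['F_p]_(2, k)) (j : 'I_k) :
  (1 < k)%N -> (k <= (s Psi).+1)%N -> row_free Psi -> col j Psi != 0.
Proof.
move=> k1 ks fr; apply/negP => /eqP vj.
have [i ij] : exists i, i != j.
  have : (0 < #|predC1 j|)%N by rewrite cardC1 card_ord; lia.
  by case/card_gt0P => i; exists i.
have [l l0 lv] := exists_perp (col i Psi); case/eqP: l0.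
by apply: (two_zeros_eq0 ks fr ij); rewrite -mulmx_col ?lv ?vj ?mulmx0 mxE.
Qed.

(** The row space seen as a linear code, shortened to the coordinates in [S]. *)
Definition codewords (p m t : nat) (M : 'M['F_p]_(m, t)) (S : {set 'I_t}) :
    {set 'rV['F_p]_t} :=
  [set c | (c <= M)%MS && [forall l, (l \notin S) ==> (c 0 l == 0)]].

Lemma codewordsP (p m t : nat) (M : 'M['F_p]_(m, t)) (S : {set 'I_t}) (c : 'rV['F_p]_t) :
  reflect ((c <= M)%MS /\ forall l, l \notin S -> c 0 l = 0) (c \in codewords M S).
Proof.
rewrite inE; apply: (iffP andP) => -[cM cS]; split=> //.
  by move=> l lS; apply/eqP; move/forallP/(_ l)/implyP: cS; apply.
by apply/forallP => l; apply/implyP => /cS ->.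
Qed.

Lemma codewords0 (p m t : nat) (M : 'M['F_p]_(m, t)) (S : {set 'I_t}) :
  0 \in codewords M S.
Proof. by apply/codewordsP; rewrite sub0mx; split=> // l _; rewrite mxE. Qed.

Lemma codewordsD (p m t : nat) (M : 'M['F_p]_(m, t)) (S : {set 'I_t}) (r : 'F_p)
    (c c' : 'rV['F_p]_t) :
  c \in codewords M S -> c' \in codewords M S -> c + r *: c' \in codewords M S.
Proof.
move=> /codewordsP[cM cS] /codewordsP[cM' cS']; apply/codewordsP.
split=> [|l lS]; first by rewrite addmx_sub // scalemx_sub.
by rewrite !mxE cS // cS' // mulr0 addr0.
Qed.

Lemma codewords_eq0 (p m t : nat) (M : 'M['F_p]_(m, t)) (S : {set 'I_t})
    (c : 'rV['F_p]_t) (i j : 'I_t) :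
  (#|S| <= (s M).+1)%N -> c \in codewords M S ->
  i \in S -> j \in S -> i != j -> c 0 i = 0 -> c 0 j = 0 -> c = 0.
Proof. by move=> Ss /codewordsP[cM cS]; exact: codeword_eq0 Ss cM cS. Qed.

(** Evaluation at two coordinates of [S] is injective. *)
Lemma card_codewords (p m t : nat) (M : 'M['F_p]_(m, t)) (S : {set 'I_t}) :
  prime p -> (1 < #|S| <= (s M).+1)%N -> (#|codewords M S| <= p ^ 2)%N.
Proof.
move=> pp /andP[/card_gt1P[i [j [iS jS ij]]] Ss].
pose f (c : 'rV['F_p]_t) := (c 0 i, c 0 j).
rewrite -(@card_in_imset _ _ f) => [|c c' cC cC' [ei ej]].
  by rewrite (leq_trans (max_card _)) // card_prod !card_Fp.
apply/eqP; rewrite -subr_eq0 -scaleN1r; apply/eqP.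
apply: (codewords_eq0 Ss _ iS jS ij); first exact: codewordsD.
  by rewrite !mxE ei mulN1r subrr.
by rewrite !mxE ej mulN1r subrr.
Qed.

(** Equality in the triangle inequality would align all terms with the value 1 taken at [i0]. *)
Lemma char_sum_strict (C : numClosedFieldType) (p : nat) (chi : 'F_p -> C)
    (I : finType) (A : {set I}) (phi : I -> 'F_p) (i0 i1 : I) :
  is_char chi -> i0 \in A -> phi i0 = 0 -> i1 \in A -> phi i1 != 0 ->
  `|\sum_(i in A) chi (phi i)| < #|A|%:R.
Proof.
move=> h i0A f0 i1A f1; have [_ h1 hn] := h.
rewrite lt_neqAle; apply/andP; split; last first.
  rewrite (le_trans (ler_norm_sum _ _ _)) // -sum1_card natr_sum ler_sum // => i _.
  by rewrite hn.
apply: contraNneq f1 => E.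
have [z _ Hz] : {z : C | `|z| == 1 & forall i, i \in A -> chi (phi i) = `|chi (phi i)| * z}.
  apply: normC_sum_eq; rewrite E -sum1_card natr_sum.
  by apply: eq_bigr => i _; rewrite hn.
have := Hz _ i0A; rewrite hn mul1r f0 (char0 h) => z1.
by rewrite -h1 (Hz _ i1A) hn -z1 mulr1.
Qed.

(* Lagrange interpolation at the points of the projective line given by the
   columns, with column [j0] placed at infinity. *)
Lemma power_relation (p k : nat) (Psi : 'M['F_p]_(2, k)) :
  (1 < k)%N -> (k <= (s Psi).+1)%N -> row_free Psi ->
  exists w : 'I_k -> 'F_p, (forall j, w j != 0) /\
    forall l : 'rV_2, \sum_j w j * ((l *m Psi) 0 j) ^+ (k - 2) = 0.
Proof.
move=> k1 ks fr; pose j0 : 'I_k := Ordinal (ltnW k1); pose j1 : 'I_k := Ordinal k1.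
have [l1 l11] := exists_dual (col_neq0 j0 k1 ks fr).
have [l2 l20 l2v] := exists_perp (col j0 Psi).
rewrite mulmx_col in l11.
have {}l2v : (l2 *m Psi) 0 j0 = 0 by rewrite -mulmx_col l2v mxE.
(* [e] and [f] are homogeneous coordinates of the columns, and [e / f] will be the affine one; [f]
   vanishes only at [j0]. *)
pose e j : 'F_p := (l1 *m Psi) 0 j; pose f j : 'F_p := (l2 *m Psi) 0 j.
have f0 j : j != j0 -> f j != 0.
  by move=> jj; apply: contraNneq l20 => fj; apply/eqP/(two_zeros_eq0 ks fr jj fj).
have lin (u v : 'rV['F_p]_2) c j : ((u - c *: v) *m Psi) 0 j =
    (u *m Psi) 0 j - c * (v *m Psi) 0 j.
  by rewrite mulmxBl -scalemxAl; move: (u *m Psi) (v *m Psi) => B D; rewrite !mxE.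
have span (l : 'rV['F_p]_2) : exists r s, forall j, (l *m Psi) 0 j = r * e j + s * f j.
  exists ((l *m Psi) 0 j0); set r := _ 0 j0.
  exists (((l - r *: l1) *m Psi) 0 j1 / f j1) => j; set s := _ / _.
  have j10 : j1 != j0 by [].
  suff E : l - r *: l1 - s *: l2 = 0.
    have := lin (l - r *: l1) l2 s j; rewrite E mul0mx mxE lin => /esym/eqP.
    by rewrite subr_eq0 subr_eq addrC => /eqP.
  apply: (two_zeros_eq0 ks fr j10).
    by rewrite lin /s divfK ?f0 // subrr.
  by rewrite !lin l2v l11 mulr1 mulr0 subr0 subrr.
pose x j := e j / f j; pose A : {set 'I_k} := [set~ j0].
have cA : #|A| = k.-1 by rewrite cardsC1 card_ord.
have xI : {in A &, injective x}.
  move=> i j; rewrite !inE => ii jj E; apply/eqP; apply/negPn/negP => ij.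
  suff E' : l1 - x i *: l2 = 0.
    have := lin l1 l2 (x i) j0; rewrite E' mul0mx mxE l11 l2v mulr0 subr0 => /esym/eqP.
    by rewrite oner_eq0.
  apply: (two_zeros_eq0 ks fr ij); rewrite lin.
    by rewrite /x divfK ?f0 ?subrr.
  by rewrite E /x divfK ?f0 ?subrr.
pose W j := \prod_(i in A :\ j) (x j - x i).
(* Lagrange denominators, corrected by the power of [f] that dehomogenises; the term at infinity
   subtracts the leading coefficient. *)
exists (fun j => if j == j0 then -1 else (W j)^-1 / f j ^+ (k - 2)); split=> [j|l].
  case: (eqVneq j j0) => [_|jj]; first by rewrite oppr_eq0 oner_eq0.
  rewrite mulf_neq0 // invr_eq0 ?expf_neq0 ?f0 //; apply/prodf_neq0 => i.
  rewrite !inE subr_eq0 => /andP[ij ii]; apply: contraNneq ij => E.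
  by apply/eqP/xI; rewrite ?inE.
have [r [s ls]] := span l.
rewrite (bigD1 j0) //= ?eqxx mulN1r ls /f l2v mulr0 addr0 /e l11 mulr1.
apply/eqP; rewrite addrC subr_eq0; apply/eqP.
(* For [l = r l1 + s l2], interpolating [(r X + s)^(k-2)] at the [k - 1] affine nodes returns
   [r^(k-2)]. *)
have [sh hc] := coef_linear_exp r s (k - 2).
have := lagrange_lead_coef xI (h := (r *: 'X + s%:P) ^+ (k - 2)).
rewrite cA (_ : k.-1.-1 = (k - 2)%N) ?hc => [<-|]; last by lia.
  apply: eq_big => [j|j jj]; first by rewrite !inE.
  rewrite (negPf jj) ls horner_exp hornerD hornerZ hornerX hornerC.
  have -> : r * e j + s * f j = f j * (r * x j + s).
    by rewrite mulrDr mulrCA [f j * x j]mulrC [f j * s]mulrC /x divfK ?f0.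
  by rewrite exprMn mulrA divfK ?expf_neq0 ?f0 // mulrC.
by rewrite (leq_trans sh) //; lia.
Qed.

(** * Signs and weights on the columns of [Psi] up to sign *)

Definition labelled (p k : nat) (Psi : 'M['F_p]_(2, k)) (j : 'I_k) (u : 'cV['F_p]_2) : bool :=
  (u == col j Psi) || (u == - col j Psi).

Definition label_sign (C : numClosedFieldType) (p k : nat) (Psi : 'M['F_p]_(2, k))
    (j0 : 'I_k) (u : 'cV['F_p]_2) : C :=
  if [exists j, labelled Psi j u] then if labelled Psi j0 u then -1 else 1 else 0.

(** For odd [p] and pairwise independent columns, this is the odd function with value [w j] at
    column [j], zero off the labelled vectors. Oddness will turn negation into conjugation of the
    character. *)
Definition label_weight (p k : nat) (Psi : 'M['F_p]_(2, k)) (w : 'I_k -> 'F_p)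
    (u : 'cV['F_p]_2) : 'F_p :=
  \sum_j ((u == col j Psi)%:R - (u == - col j Psi)%:R) * w j.

Lemma labelledN (p k : nat) (Psi : 'M['F_p]_(2, k)) (j : 'I_k) (u : 'cV['F_p]_2) :
  labelled Psi j (- u) = labelled Psi j u.
Proof. by rewrite /labelled eqr_oppLR eqr_opp orbC. Qed.

Lemma label_signN (C : numClosedFieldType) (p k : nat) (Psi : 'M['F_p]_(2, k))
    (j0 : 'I_k) (u : 'cV['F_p]_2) :
  label_sign C Psi j0 (- u) = label_sign C Psi j0 u.
Proof.
rewrite /label_sign labelledN; congr (if _ then _ else _).
by apply: eq_existsb => j; rewrite labelledN.
Qed.

Lemma label_weightN (p k : nat) (Psi : 'M['F_p]_(2, k)) (w : 'I_k -> 'F_p)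
    (u : 'cV['F_p]_2) :
  label_weight Psi w (- u) = - label_weight Psi w u.
Proof.
rewrite /label_weight -sumrN; apply: eq_bigr => j _.
by rewrite eqr_oppLR eqr_opp -mulNr opprB.
Qed.

Lemma label_weight0 (p k : nat) (Psi : 'M['F_p]_(2, k)) (w : 'I_k -> 'F_p) :
  label_weight Psi w 0 = 0.
Proof.
rewrite /label_weight big1 // => j _.
by rewrite !(eq_sym 0) oppr_eq0 subrr mul0r.
Qed.

Lemma label_sign0 (C : numClosedFieldType) (p k : nat) (Psi : 'M['F_p]_(2, k)) (j0 : 'I_k) :
  (1 < k)%N -> (k <= (s Psi).+1)%N -> row_free Psi -> label_sign C Psi j0 0 = 0.
Proof.
move=> k1 ks fr; rewrite /label_sign; case: existsP => // -[j].
by rewrite /labelled !(eq_sym 0) oppr_eq0 orbb (negPf (col_neq0 _ k1 ks fr)).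
Qed.

Lemma labelled_mul0 (p k : nat) (Psi : 'M['F_p]_(2, k)) (j : 'I_k) (u : 'cV['F_p]_2)
    (l : 'rV['F_p]_2) :
  labelled Psi j u -> ((l *m Psi) 0 j == 0) = ((l *m u) 0 0 == 0).
Proof.
by rewrite -mulmx_col => /orP[] /eqP -> //; rewrite mulmxN [in RHS]mxE oppr_eq0.
Qed.

Lemma labelled_inj (p k : nat) (Psi : 'M['F_p]_(2, k)) (i j : 'I_k) (u : 'cV['F_p]_2) :
  (k <= (s Psi).+1)%N -> row_free Psi ->
  labelled Psi i u -> labelled Psi j u -> i = j.
Proof.
move=> ks fr ui uj; apply/eqP/negPn/negP => ij.
have [l l0 lu] := exists_perp u; case/eqP: l0.
by apply: (two_zeros_eq0 ks fr ij); apply/eqP;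
  rewrite (labelled_mul0 _ ui, labelled_mul0 _ uj) lu mxE.
Qed.

Lemma label_weight_col (p k : nat) (Psi : 'M['F_p]_(2, k)) (w : 'I_k -> 'F_p) (j : 'I_k) :
  prime p -> (2 < p)%N -> (1 < k)%N -> (k <= (s Psi).+1)%N -> row_free Psi ->
  label_weight Psi w (col j Psi) = w j.
Proof.
move=> pp p2 k1 ks fr; rewrite /label_weight (bigD1 j) //= big1 ?addr0 => [|i ij].
  have -> : (col j Psi == - col j Psi) = false.
    apply/negP; rewrite -addr_eq0 -mulr2n -scaler_nat scaler_eq0.
    rewrite (negPf (col_neq0 _ k1 ks fr)) orbF.
    by rewrite -(dvdn_pcharf (pchar_Fp pp)) gtnNdvd.
  by rewrite eqxx subr0 mul1r.
have : labelled Psi i (col j Psi) = false.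
  apply/negP => H; case/eqP: ij; apply: (labelled_inj ks fr H).
  by rewrite /labelled eqxx.
by rewrite /labelled => /norP[/negPf -> /negPf ->]; rewrite subrr mul0r.
Qed.

(** * Classification of the leading contributions *)

Lemma leading_term_cases (C : numClosedFieldType) (p m t k : nat)
    (Psi : 'M['F_p]_(2, k)) (M : 'M['F_p]_(m, t)) (chi : 'F_p -> C)
    (w : 'I_k -> 'F_p) (j0 : 'I_k) (U : 'M['F_p]_(2, t)) (S := [set i | col i U != 0])
    (alpha := \prod_(i | col i U != 0) label_sign C Psi j0 (col i U))
    (E := \sum_(c in codewords M S)
       chi (\sum_i label_weight Psi w (col i U) * c 0 i ^+ (k - 2))) :
  prime p -> (2 < p)%N -> (3 < k)%N -> ~~ odd k ->
  s Psi = k.-1 -> row_free Psi -> s M = k.-1 -> is_char chi ->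
  (forall j, w j != 0) -> (U <= M)%MS -> col_weight U = k ->
  [\/ alpha = 0, `|E| < (p ^ 2)%:R | E = (p ^ 2)%:R /\ alpha = -1].
Proof.
move=> pp p2 k3 kev sPsi fr sM h w0 UM wU.
have k1 : (1 < k)%N by lia.
have ks : (k <= (s Psi).+1)%N by rewrite sPsi; lia.
have cS : #|S| = k by rewrite -wU cardsE.
have Ss : (#|S| <= (s M).+1)%N by rewrite cS sM; lia.
have cC : (#|codewords M S| <= p ^ 2)%N by apply: card_codewords; rewrite // Ss cS k1.
pose phi (c : 'rV['F_p]_t) := \sum_i label_weight Psi w (col i U) * c 0 i ^+ (k - 2).
have phi0 : phi 0 = 0.
  by rewrite /phi big1 // => i _; rewrite mxE expr0n (_ : (_ == _) = false) ?mulr0 //; lia.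
case: (eqVneq alpha 0) => [a0|a0]; first by apply: Or31.
case: (boolP [exists c in codewords M S, phi c != 0]) => [/existsP[c /andP[cc fc]]|nex].
  apply: Or32; apply: lt_le_trans (char_sum_strict h (codewords0 M S) phi0 cc fc) _.
  by rewrite ler_nat.
have {nex}phiE c : c \in codewords M S -> phi c = 0.
  move=> cc; apply/eqP; apply: contraNT nex => fc; apply/existsP; exists c.
  by rewrite cc.
have EE : E = #|codewords M S|%:R.
  rewrite /E -sum1_card natr_sum; apply: eq_bigr => c /phiE; rewrite /phi => ->.
  by rewrite (char0 h).
move: cC; rewrite leq_eqVlt => /predU1P[cC|lt]; last first.
  by apply: Or32; rewrite EE ger0_norm // ltr_nat.
apply: Or33; split; first by rewrite EE cC.
have lab i : i \in S -> exists j, labelled Psi j (col i U).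
  rewrite inE => iS; apply/existsP; apply: contraNT a0 => H.
  by rewrite /alpha (bigD1 i) //= {1}/label_sign (negPf H) mul0r.
pose f i := odflt j0 [pick j | labelled Psi j (col i U)].
have fP i : i \in S -> labelled Psi (f i) (col i U).
  by move=> /lab[j uj]; rewrite /f; case: pickP => [//|/(_ j)]; rewrite uj.
have rowS l : l *m U \in codewords M S.
  apply/codewordsP; split=> [|i]; first by rewrite (submx_trans _ UM) ?submxMl.
  by rewrite inE negbK => /eqP ci; rewrite -mulmx_col ci mulmx0 mxE.
(* Suppose two columns share the label [j]. If [l] kills column [j] of [Psi], then [l *m U] has two
   zeros in [S], so it vanishes; hence every column in [S] has label [j]. *)
have fI : {in S &, injective f}.
  move=> i i' iS iS' fii; apply/eqP/negPn/negP => ii.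
  have uj := fP _ iS; have uj' := fP _ iS'; rewrite -fii in uj'; set j := f i in uj uj'.
  have [l l0 lj] := exists_perp (col j Psi).
  have lj0 : (l *m Psi) 0 j = 0 by rewrite -mulmx_col lj mxE.
  have lU : l *m U = 0.
    apply: (codewords_eq0 Ss (rowS l) iS iS' ii); apply/eqP; rewrite -mulmx_col.
      by rewrite -(labelled_mul0 _ uj) lj0.
    by rewrite -(labelled_mul0 _ uj') lj0.
  have allj i1 : i1 \in S -> labelled Psi j (col i1 U).
    move=> iS1; have u1 := fP _ iS1; suff -> : j = f i1 by [].
    apply/eqP/negPn/negP => jf; case/eqP: l0.
    apply: (two_zeros_eq0 ks fr jf) => //; apply/eqP.
    by rewrite (labelled_mul0 _ u1) mulmx_col lU mxE.
  have [l1 l1j] := exists_dual (col_neq0 j k1 ks fr).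
  (* On [S], [e] records the sign of each column of [U] relative to column [j] of [Psi]. *)
  pose e := l1 *m U.
  have eS i1 : i1 \in S -> col i1 U = e 0 i1 *: col j Psi /\ (e 0 i1 = 1 \/ e 0 i1 = -1).
    move=> /allj /orP[] /eqP ci; rewrite /e -mulmx_col ci.
      by rewrite l1j scale1r; split=> //; left.
    by rewrite mulmxN mxE l1j scaleN1r; split=> //; right.
  have e2 i1 : i1 \in S -> e 0 i1 * e 0 i1 = 1.
    by move=> /eS[_ [->|->]]; rewrite ?mulrNN mulr1.
  have sum0 c : c \in codewords M S -> \sum_(i1 in S) e 0 i1 * c 0 i1 ^+ (k - 2) = 0.
    move=> /phiE; rewrite /phi (bigID (mem S)) /= [X in _ + X]big1 ?addr0; last first.
      by move=> i1; rewrite inE negbK => /eqP ->; rewrite label_weight0 mul0r.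
    move=> E0; apply: (mulfI (w0 j)); rewrite mulr0 -[RHS]E0 big_distrr.
    apply: eq_bigr => i1 /eS[-> e1] /=; rewrite mulrCA mulrA; congr (_ * _).
    case: e1 => ->; rewrite ?scale1r ?scaleN1r ?label_weightN label_weight_col //.
      by rewrite mul1r.
    by rewrite mulN1r.
  have entry (c c' : 'rV['F_p]_t) r i1 : (c + r *: c') 0 i1 = c 0 i1 + r * c' 0 i1.
    by rewrite !mxE.
  (* The multiples of [e] are at most [p] of the [p^2] codewords. *)
  have [c cc cne] : exists2 c, c \in codewords M S & forall r, c != r *: e.
    pose X := [set r *: e | r : 'F_p].
    have : ~~ (codewords M S \subset X).
      apply/negP => /subset_leq_card; rewrite cC; apply/negP; rewrite -ltnNge.
      rewrite (leq_ltn_trans (leq_imset_card _ _)) // card_Fp //.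
      by rewrite -[X in (X < _)%N]expn1 ltn_exp2l // prime_gt1.
    case/subsetPn => c cc cX; exists c => // r; apply: contraNneq cX => ->.
    exact: imset_f.
  (* A coincidence would give a multiple of [e] agreeing with [c] at two places of [S], hence equal
     to [c]. *)
  have mI : {in S &, injective (fun i1 => c 0 i1 * e 0 i1)}.
    move=> i1 i2 iS1 iS2 E12; apply/eqP/negPn/negP => i12.
    have E0 : c + - (c 0 i1 * e 0 i1) *: e = 0.
      apply: (codewords_eq0 Ss (codewordsD _ cc (rowS l1)) iS1 iS2 i12); rewrite -/e entry.
        by rewrite mulNr -mulrA e2 // mulr1 subrr.
      by rewrite E12 mulNr -mulrA e2 // mulr1 subrr.
    have := cne (c 0 i1 * e 0 i1); rewrite -subr_eq0 -scaleNr E0 eqxx //.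
  have kS : (3 < #|S|)%N by rewrite cS.
  have evS : ~~ odd #|S| by rewrite cS.
  (* The codeword [c + r e] has entries [e_i (r + m_i)] with [m_i = c_i e_i]; as [k - 2] is even,
     its zero phase is the forbidden identity. *)
  apply: (signed_powers_nonzero pp kS evS mI (e := e 0)) => [i1 /eS[]//|r].
  rewrite cS -[RHS](sum0 _ (codewordsD r cc (rowS l1))).
  apply: eq_bigr => i1 iS1; congr (_ * _).
  have -> : (c + r *: e) 0 i1 = e 0 i1 * (r + c 0 i1 * e 0 i1).
    by rewrite entry mulrDr mulrCA e2 // mulr1 addrC [r * _]mulrC.
  rewrite exprMn (_ : e 0 i1 ^+ (k - 2) = 1) ?mul1r //.
  by case: (eS _ iS1) => _ [->|->]; rewrite ?expr1n // -signr_odd oddB ?(negPf kev) //; lia.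
(* Since [S] has [k] elements, [f] is a bijection onto the labels, so [j0] occurs exactly once. *)
have [i0 i0S fi0] : exists2 i, i \in S & f i = j0.
  have : j0 \in [set f i | i in S].
    suff -> : [set f i | i in S] = setT by rewrite inE.
    apply/eqP; rewrite eqEcard subsetT cardsT card_ord card_in_imset // cS leqnn //.
  by case/imsetP => i iS ->; exists i.
have i0S' := i0S; rewrite inE in i0S'.
have fsign i : i \in S -> label_sign C Psi j0 (col i U) = if i == i0 then -1 else 1.
  move=> iS; rewrite /label_sign; have -> : [exists j, labelled Psi j (col i U)].
    by apply/existsP; exact: lab.
  case: (eqVneq i i0) => [->|ii]; first by rewrite -fi0 fP.
  case: ifP => // u0; case/eqP: ii; apply: fI => //.
  by rewrite fi0; apply: (labelled_inj ks fr (fP _ iS)).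
rewrite /alpha (bigD1 i0) //= fsign // eqxx big1 ?mulr1 // => i /andP[iS ii].
by rewrite fsign ?inE // (negPf ii).
Qed.

(** * Factorisation over the extra coordinates *)

(** Split [U] into blocks [U1] over [U2]. As [a 0 = 0], only [U2] supported on the columns of [U1]
    count; their [N] rows range independently over codewords and the phase is additive in them,
    giving an [N]-th power. *)
Lemma leading_sum_factor (C : numClosedFieldType) (p m t n N k d : nat)
    (M : 'M['F_p]_(m, t)) (chi : 'F_p -> C) (a : 'cV['F_p]_n -> C)
    (q : 'cV['F_p]_n -> 'F_p)
    (G := fun u : 'cV['F_p]_(n + N) =>
       a (usubmx u) * chi (q (usubmx u) * \sum_i dsubmx u i 0 ^+ d)) :
  is_char chi -> a 0 = 0 -> q 0 = 0 ->
  \sum_(U : 'M['F_p]_(n + N, t) | (U <= M)%MS && (col_weight U == k))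
    \prod_(i | col i U != 0) G (col i U) =
  \sum_(U : 'M['F_p]_(n, t) | (U <= M)%MS && (col_weight U == k))
    (\prod_(i | col i U != 0) a (col i U)) *
    (\sum_(c in codewords M [set i | col i U != 0])
       chi (\sum_i q (col i U) * c 0 i ^+ d)) ^+ N.
Proof.
move=> h a0 q0.
rewrite (reindex (fun V : 'M['F_p]_(n, t) * 'M['F_p]_(N, t) => col_mx V.1 V.2)) /=; last first.
  exists (fun U => (usubmx U, dsubmx U)) => [[V1 V2] _|U _] /=.
    by rewrite col_mxKu col_mxKd.
  by rewrite vsubmxK.
rewrite -(pair_big_dep xpredT (fun V1 V2 => (col_mx V1 V2 <= M)%MS && (col_weight (col_mx V1 V2) == k))
  (fun V1 V2 => \prod_(i | col i (col_mx V1 V2) != 0) G (col i (col_mx V1 V2)))) /=.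
rewrite [RHS]big_mkcond /=; apply: eq_bigr => U1 _.
have colE' (U2 : 'M['F_p]_(N, t)) i : col i (col_mx U1 U2) = col_mx (col i U1) (col i U2).
  by rewrite !colE mul_col_mx.
have col_neq (U2 : 'M['F_p]_(N, t)) i :
    (col i (col_mx U1 U2) != 0) = (col i U1 != 0) || (col i U2 != 0).
  by rewrite colE' col_mx_eq0 negb_and.
have GE (U2 : 'M['F_p]_(N, t)) i : G (col i (col_mx U1 U2)) =
    a (col i U1) * chi (q (col i U1) * \sum_j U2 j i ^+ d).
  rewrite /G colE' col_mxKu col_mxKd; congr (_ * chi (_ * _)).
  by apply: eq_bigr => j _; rewrite mxE.
set S := [set i | col i U1 != 0].
under eq_bigr do under eq_bigr do rewrite GE.
transitivity (\sum_(U2 : 'M['F_p]_(N, t) | (U1 <= M)%MS && (col_weight U1 == k) &&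
    [forall j, row j U2 \in codewords M S])
  (\prod_(i | col i U1 != 0) a (col i U1)) *
    \prod_j chi (\sum_i q (col i U1) * (row j U2) 0 i ^+ d)); last first.
  case: ifP => _ /=; last by rewrite big_pred0.
  rewrite -big_distrr /=; congr (_ * _).
  rewrite -[N in _ ^+ N]card_ord -prodr_const bigA_distr_big /=.
  rewrite (reindex (fun f : {ffun 'I_N -> 'rV['F_p]_t} => \matrix_j f j)) /=; last first.
    exists (fun U2 => [ffun j => row j U2]) => [f _|U2 _].
      by apply/ffunP => j; rewrite ffunE rowK.
    by apply/row_matrixP => j; rewrite rowK ffunE.
  apply: eq_big => [f|f _]; last by apply: eq_bigr => j _; rewrite rowK.
  apply/forallP/ffun_onP => H j; first by have := H j; rewrite rowK.
  by rewrite rowK.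
rewrite big_mkcond [RHS]big_mkcond /=; apply: eq_bigr => U2 _.
(* If [U2] is nonzero in a column where [U1] vanishes, the left term is zero and the right-hand
   condition fails. *)
case: (boolP [exists i, (col i U1 == 0) && (col i U2 != 0)]) => [/existsP[i /andP[c1 c2]]|H].
  rewrite [RHS]ifF; last first.
    apply/negP => /andP[_ /forallP H]; case/eqP: c2; apply/colP => j.
    have /codewordsP[_ /(_ i)] := H j; rewrite !inE c1 !mxE; exact.
  case: ifP => // _; rewrite (bigD1 i) /=; last by rewrite col_neq c2 orbT.
  by rewrite (eqP c1) a0 !mul0r.
have sup i : col i U2 != 0 -> col i U1 != 0.
  by move=> c2; apply: contraNN H => c1; apply/existsP; exists i; rewrite c1.
have neq i : (col i (col_mx U1 U2) != 0) = (col i U1 != 0).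
  by rewrite col_neq; apply/orP/idP => [[//|/sup //]|->]; left.
have -> : col_weight (col_mx U1 U2) = col_weight U1.
  by apply: eq_card => i; rewrite !inE neq.
have -> : [forall j, row j U2 \in codewords M S] = (U2 <= M)%MS.
  apply/forallP/row_subP => HH j; first by have /codewordsP[] := HH j.
  apply/codewordsP; split=> // i; rewrite inE negbK => c1.
  have : col i U2 == 0 by apply: contraTT c1 => /sup.
  by move/eqP/colP/(_ j); rewrite !mxE.
rewrite -addsmxE addsmx_sub andbAC; case: ifP => // _.
rewrite (eq_bigl _ _ neq) big_split /=; congr (_ * _).
transitivity (\prod_i chi (q (col i U1) * \sum_j U2 j i ^+ d)).
  rewrite [RHS](bigID (fun i => col i U1 != 0)) /= [X in _ = _ * X]big1 ?mulr1 //.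
  by move=> i /negbNE/eqP ->; rewrite q0 mul0r (char0 h).
rewrite -char_sum // -char_sum //; congr chi.
under eq_bigr do rewrite big_distrr /=.
rewrite exchange_big; apply: eq_bigr => j _; apply: eq_bigr => i _.
by rewrite mxE.
Qed.

(** * The embedded copy of [Psi] and the conclusion *)

(** [U] is [M] extended by zero columns along [b]. The columns of [cokermx M'] form one solution
    with [n = t]; that [U] kills it places [U] in the row space of [M']. *)
Lemma contains_extension (p m t l k : nat) (M' : 'M['F_p]_(m, t)) (M : 'M['F_p]_(l, k)) :
  (0 < t)%N -> contains M' M ->
  exists2 b : 'I_k -> 'I_t, injective b & exists2 U : 'M['F_p]_(l, t), (U <= M')%MS &
    (forall j, col (b j) U = col j M) /\ (forall i, i \notin codom b -> col i U = 0).
Proof.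
move=> t0 [b bI bsol]; exists b => //.
pose B : 'M['F_p]_(k, t) := \matrix_(j, i) (i == b j)%:R.
have rowsubB n (x : 'M['F_p]_(t, n)) : rowsub b x = B *m x.
  apply/matrixP => j i; rewrite !mxE (bigD1 (b j)) //= mxE eqxx mul1r big1 ?addr0 //.
  by move=> i' /negPf ib; rewrite mxE ib mul0r.
exists (M *m B).
  have := bsol t t0 (cokermx M'); rewrite !inE mulmx_coker eqxx => /(_ isT).
  by rewrite rowsubB mulmxA -submxE.
have E i r : (M *m B) r i = \sum_j M r j * (i == b j)%:R.
  by rewrite !mxE; apply: eq_bigr => j _; rewrite mxE.
split=> [j|i ib]; apply/colP => r; rewrite mxE E.
  rewrite (bigD1 j) //= eqxx mulr1 big1 ?addr0 ?mxE // => j' jj.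
  by rewrite (inj_eq bI) eq_sym (negPf jj) mulr0.
rewrite mxE big1 // => j _; case: eqP ib => [->|]; last by rewrite mulr0.
by rewrite codom_f.
Qed.

Theorem theorem1p2 (R : realType) :
  exists p0 : nat, forall p : nat, prime p -> (p0 <= p)%N ->
  forall k : nat, (4 <= k)%N -> ~~ odd k ->
  forall Psi : 'M['F_p]_(2, k), is_system Psi -> s Psi = k.-1 ->
  forall m t : nat, (2 <= m)%N -> (k <= t)%N ->
  forall Psi' : 'M['F_p]_(m, t), is_system Psi' -> s Psi' = k.-1 ->
  contains Psi' Psi -> uncommon R Psi'.
Proof.
(* The bound 3 makes [p] odd, so no nonzero column equals its own negative. *)
exists 3 => p pp p3 k k4 kev Psi /andP[_ fr] sPsi m t _ kt M _ sM cont.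
have k1 : (1 < k)%N by lia.
have ks : (k <= (s Psi).+1)%N by rewrite sPsi; lia.
have [chi h] := exists_char R[i] pp.
have [w [w0 wP]] := power_relation k1 ks fr.
pose j0 : 'I_k := Ordinal (ltnW k1).
pose a := label_sign R[i] Psi j0; pose q := label_weight Psi w.
have a0 : a 0 = 0 by exact: label_sign0.
have q0 : q 0 = 0 by exact: label_weight0.
pose alpha (U : 'M['F_p]_(2, t)) := \prod_(i | col i U != 0) a (col i U).
pose z (U : 'M['F_p]_(2, t)) := \sum_(c in codewords M [set i | col i U != 0])
   chi (\sum_i q (col i U) * c 0 i ^+ (k - 2)).
have cases U : (U <= M)%MS && (col_weight U == k) ->
    [\/ alpha U = 0, `|z U| < (p ^ 2)%:R | z U = (p ^ 2)%:R /\ alpha U = -1].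
  by move=> /andP[UM /eqP wU]; exact: leading_term_cases.
have [U UM zU] : exists2 U, (U <= M)%MS && (col_weight U == k) &
    z U = (p ^ 2)%:R /\ alpha U = -1.
  have [b bI [U UM [Ub U0]]] := contains_extension (leq_trans (ltnW k1) kt) cont.
  have Uneq i : (col i U != 0) = (i \in codom b).
    case: (boolP (i \in codom b)) => [/codomP[j ->]|/U0 ->]; last by rewrite eqxx.
    by rewrite Ub col_neq0.
  have wU : col_weight U = k.
    rewrite -[RHS]card_ord -(card_codom bI); apply: eq_card => i.
    by rewrite inE Uneq.
  have UMk : (U <= M)%MS && (col_weight U == k) by rewrite UM wU eqxx.
  exists U => //.
  pose S := [set i | col i U != 0].
  have Ss : (1 < #|S| <= (s M).+1)%N by rewrite cardsE -/(col_weight U) wU sM k1; lia.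
  have rowS (l : 'rV_2) : l *m U \in codewords M S.
    apply/codewordsP; split=> [|i]; first by rewrite (submx_trans _ UM) ?submxMl.
    by rewrite inE negbK => /eqP ci; rewrite -mulmx_col ci mulmx0 mxE.
  have lU (l : 'rV_2) j : (l *m U) 0 (b j) = (l *m Psi) 0 j.
    by rewrite -mulmx_col Ub mulmx_col.
  have lI : injective (fun l : 'rV['F_p]_2 => l *m U).
    move=> l l' E; apply: (row_free_inj fr); apply/rowP => j.
    by have := congr1 (fun c : 'rV['F_p]_t => c 0 (b j)) E; rewrite /= (lU l) (lU l').
  (* The [p^2] combinations of the rows of [U] already exhaust the upper bound on codewords; the
     power relation makes the phase vanish on each. *)
  have cwE : codewords M S = [set l *m U | l : 'rV_2].
    apply/esym/eqP; rewrite eqEcard; apply/andP; split.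
      by apply/subsetP => _ /imsetP[l _ ->].
    rewrite card_imset // card_mx card_Fp // mul1n; exact: card_codewords.
  have zU : z U = (p ^ 2)%:R.
    rewrite /z -/S cwE big_imset /=; last by move=> ? ? _ _; exact: lI.
    rewrite (eq_bigr (fun=> 1)) => [|l _]; first by rewrite sumr_const card_mx card_Fp.
    rewrite (_ : \sum_i _ = 0) ?(char0 h) // (bigID (mem (codom b))) /=.
    rewrite [X in _ + X]big1 ?addr0 => [|i ib]; last by rewrite U0 // q0 mul0r.
    rewrite -[RHS](wP l).
    rewrite (eq_bigl (fun i => i \in [set b j | j in 'I_k])); last first.
      by move=> i; apply/codomP/imsetP => -[j]; [exists j | move=> _; exists j].
    rewrite big_imset /=; last by move=> ? ? _ _; exact: bI.
    by apply: eq_bigr => j _; rewrite Ub lU /q label_weight_col.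
  (* The value of [alpha U] is read off the trichotomy: it is a product of signs, hence nonzero, and
     [z U] has full modulus. *)
  split=> //; case: (cases U UMk) => [al|lt|[]//]; last first.
    by move: lt; rewrite zU normr_nat ltxx.
  suff /eqP : alpha U != 0 by rewrite al.
  apply/prodf_neq0 => i; rewrite Uneq => /codomP[j ->].
  rewrite Ub /a /label_sign; have -> : [exists j', labelled Psi j' (col j Psi)].
    by apply/existsP; exists j; rewrite /labelled eqxx.
  by case: ifP; rewrite ?oppr_eq0 oner_neq0.
have p20 : 0 < (p ^ 2)%:R :> R[i] by rewrite ltr0n expn_gt0 prime_gt0.
case: zU => zU aU.
have [N [c Hc]] := power_sum_dominated p20 cases UM zU aU.
pose G (u : 'cV['F_p]_(2 + N)) :=
  a (usubmx u) * chi (q (usubmx u) * \sum_i dsubmx u i 0 ^+ (k - 2)).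
apply: (@uncommon_of_leading_term R p m t (2 + N) k M chi G c h) => //.
- lia.
- by rewrite /G (_ : usubmx 0 = 0) ?a0 ?mul0r //; apply/matrixP => i j; rewrite !mxE.
(* Negation preserves the sign and, [k - 2] being even, the power sum; it negates the weight, which
   conjugates the character. *)
- move=> u; rewrite /G rmorphM /= -(charN _ h).
  have -> : usubmx (- u) = - usubmx u by apply/matrixP => i j; rewrite !mxE.
  rewrite /a label_signN /q label_weightN; congr (_ * chi _).
    rewrite /label_sign; case: ifP => _; last by rewrite rmorph0.
    by case: ifP; rewrite ?rmorphN rmorph1.
  rewrite mulNr; congr (- (_ * _)); apply: eq_bigr => i _.
  by rewrite !mxE exprNn -signr_odd oddB ?(negPf kev) ?mul1r //; lia.
by rewrite leading_sum_factor.
Qed.
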